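(* Let $R,S$ be finite digraphs, let $\mathfrak{D}'$ be a class of finite digraphs, and let $\mathcal{E}(R),\mathcal{E}(S)$, $\phi_R,\phi_S$, $\alpha^R,\alpha^S$ be as in the context. Let $\rho$ be an S-scheme from $R$ to $S$ with respect to $\mathfrak{D}'$. (1) If $\rho$ is induced by some strict homomorphism $\epsilon:\mathcal{E}(R)\to\mathcal{E}(S)$, then for all $G,H\in\mathfrak{D}'$, $\xi\in\mathcal{S}(G,R)$, $\zeta\in\mathcal{S}(H,R)$, $v\in V(G)$, $w\in V(H)$: $$\alpha^R_{G,\xi}(v)=\alpha^R_{H,\zeta}(w)\ \Longrightarrow\ \rho_G(\xi)(v)=\rho_H(\zeta)(w).\qquad(\ast)$$ (2) Conversely, if ERD and AID hold and $\rho$ satisfies $(\ast)$, then $\rho$ is induced by the strict homomorphism $\alpha^S_{\mathcal{E}(R),\,\rho_{\mathcal{E}(R)}(\phi_R)}:\mathcal{E}(R)\to\mathcal{E}(S)$.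
   Context: Digraphs $G=(V(G),A(G))$ have a finite nonempty vertex set and $A(G)\subseteq V(G)\times V(G)$; loops are allowed, and $vw$ denotes $(v,w)$. An arc $vw$ is proper if $v\neq w$. A homomorphism $\xi:G\to H$ is a map $V(G)\to V(H)$ with $\xi(v)\xi(w)\in A(H)$ for all $vw\in A(G)$. It is strict if, in addition, it maps every proper arc of $G$ to a proper arc of $H$. $\mathcal{S}(G,H)$ denotes the set of strict homomorphisms from $G$ to $H$. $\mathfrak{D}'$ is a class of finite digraphs taken up to isomorphism: constructed digraphs are identified with their representatives. An S-scheme from $R$ to $S$ with respect to $\mathfrak{D}'$ is a family $\rho=(\rho_G)_{G\in\mathfrak{D}'}$ of maps $\rho_G:\mathcal{S}(G,R)\to\mathcal{S}(G,S)$. Auxiliary data: - $\mathcal{E}(R),\mathcal{E}(S)$ are finite digraphs with vertex sets $\mathcal{E}_o(R),\mathcal{E}_o(S)$. - $\phi_R\in\mathcal{S}(\mathcal{E}(R),R)$ and $\phi_S\in\mathcal{S}(\mathcal{E}(S),S)$. - $\alpha^R$ is an S-scheme from $R$ to $\mathcal{E}(R)$ with respect to $\mathfrak{D}'$, written $\xi\mapsto\alpha^R_{G,\xi}\in\mathcal{S}(G,\mathcal{E}(R))$, such that $\phi_R\circ\alpha^R_{G,\xi}=\xi$ for all $G\in\mathfrak{D}'$ and $\xi\in\mathcal{S}(G,R)$. - $\alpha^S$ is an S-scheme from $S$ to $\mathcal{E}(S)$ with $\phi_S\circ\alpha^S_{G,\zeta}=\zeta$ for all $G\in\mathfrak{D}'$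 and $\zeta\in\mathcal{S}(G,S)$. Given a strict homomorphism $\epsilon:\mathcal{E}(R)\to\mathcal{E}(S)$, the S-scheme induced by $\epsilon$ is $\eta_G(\xi)=\phi_S\circ\epsilon\circ\alpha^R_{G,\xi}$ for $G\in\mathfrak{D}'$ and $\xi\in\mathcal{S}(G,R)$. We say $\rho$ is induced by $\epsilon$ if $\rho_G(\xi)=\eta_G(\xi)$ for all such $G,\xi$. ERD means $\mathcal{E}(R)\in\mathfrak{D}'$. AID means that ERD holds and $\alpha^R_{\mathcal{E}(R),\phi_R}$ is the identity map of $\mathcal{E}_o(R)$. *)

(* Defs.v *)
From HB Require Import structures.
From mathcomp Require Import all_boot.

Set Implicit Arguments.
Unset Strict Implicit.
Unset Printing Implicit Defensive.

Record digraph := Digraph {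
  vertex :> finType;
  arc : rel vertex;
  digraph_nonempty : 0 < #|vertex| }.

Definition proper_arc (G : digraph) : rel G :=
  fun v w => arc v w && (v != w).

Definition is_hom (G H : digraph) (f : G -> H) : bool :=
  [forall v, forall w, arc v w ==> arc (f v) (f w)].

Definition is_strict_hom (G H : digraph) (f : G -> H) : bool :=
  is_hom f && [forall v, forall w, proper_arc v w ==> proper_arc (f v) (f w)].

(* The underlying map is a [{ffun _}], so Leibniz equality of strict
   homomorphisms is equality of maps. *)
Record shom (G H : digraph) := SHom {
  shom_fun :> {ffun G -> H};
  shom_strict : is_strict_hom shom_fun }.

HB.instance Definition _ (G H : digraph) := [isSub for @shom_fun G H].

Lemma shom_comp_strict (G H K : digraph) (g : shom H K) (f : shom G H) :
  is_strict_hom [ffun v => g (f v)].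
Proof.
have /andP [/forallP gh /forallP gs] := shom_strict g.
have /andP [/forallP fh /forallP fs] := shom_strict f.
apply/andP; split; apply/forallP => v; apply/forallP => w; apply/implyP => vw;
  rewrite /= !ffunE.
- have := forallP (gh (f v)) (f w).
  by rewrite (implyP (forallP (fh v) w) vw).
- have := forallP (gs (f v)) (f w).
  by rewrite (implyP (forallP (fs v) w) vw).
Qed.

Definition shom_comp (G H K : digraph) (g : shom H K) (f : shom G H) :
  shom G K := SHom (shom_comp_strict g f).

(* [D] is an arbitrary predicate on digraphs; it may be a system of
   representatives of isomorphism classes or an isomorphism-closed class. *)
Definition scheme (D : digraph -> Prop) (R S : digraph) :=
  forall G : digraph, D G -> shom G R -> shom G S.

Definition lifts_through (D : digraph -> Prop) (R ER : digraph)
    (phi : shom ER R) (alpha : scheme D R ER) : Prop :=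
  forall (G : digraph) (hG : D G) (xi : shom G R),
    shom_comp phi (alpha G hG xi) = xi.

Definition induced_scheme (D : digraph -> Prop) (R S ER ES : digraph)
    (phiS : shom ES S) (alphaR : scheme D R ER) (eps : shom ER ES) :
  scheme D R S :=
  fun G hG xi => shom_comp phiS (shom_comp eps (alphaR G hG xi)).

Definition induced_by (D : digraph -> Prop) (R S ER ES : digraph)
    (phiS : shom ES S) (alphaR : scheme D R ER)
    (rho : scheme D R S) (eps : shom ER ES) : Prop :=
  forall (G : digraph) (hG : D G) (xi : shom G R),
    rho G hG xi = induced_scheme phiS alphaR eps hG xi.

Definition ERD (D : digraph -> Prop) (ER : digraph) : Prop := D ER.

Definition AID (D : digraph -> Prop) (R ER : digraph) (phiR : shom ER R)
    (alphaR : scheme D R ER) (hE : ERD D ER) : Prop :=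
  forall a : ER, alphaR ER hE phiR a = a.

(* Main.v *)
Require Import Defs.
From mathcomp Require Import all_boot.

(* Under AID, (star) compares [xi] at [v] with [phiR] at [alphaR xi v], so [rho]
   is determined by its value at [phiR]; lifting that value through [phiS]
   gives the inducing homomorphism. *)

Theorem theorem3 (R S : digraph) (D : digraph -> Prop) (ER ES : digraph)
    (phiR : shom ER R) (phiS : shom ES S)
    (alphaR : scheme D R ER) (alphaS : scheme D S ES)
    (halphaR : lifts_through phiR alphaR)
    (halphaS : lifts_through phiS alphaS)
    (rho : scheme D R S) :
  let star :=
    forall (G H : digraph) (hG : D G) (hH : D H)
           (xi : shom G R) (zeta : shom H R) (v : G) (w : H),
      alphaR G hG xi v = alphaR H hH zeta w ->
      rho G hG xi v = rho H hH zeta w in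
  ((exists eps : shom ER ES, induced_by phiS alphaR rho eps) -> star)
  /\
  (forall hE : ERD D ER, AID phiR alphaR hE -> star ->
     induced_by phiS alphaR rho (alphaS ER hE (rho ER hE phiR))).
Proof.
move=> star; split=> [[eps rho_eps] G H hG hH xi zeta v w eq_alpha | hE aid hstar G hG xi].
  (* An induced scheme sees [v] only through [alphaR G hG xi v], to which the fixed map [phiS] after
     [eps] is applied. *)
  by rewrite !rho_eps /= !ffunE eq_alpha.
apply/val_inj/ffunP => v; rewrite /= !ffunE.
have -> : rho G hG xi v = rho ER hE phiR (alphaR G hG xi v).
  (* [star] is used with [H := ER], [zeta := phiR] and [w := alphaR G hG xi v]; [aid] collapses its
     premise to reflexivity. *)
  by apply: hstar; rewrite aid.
(* Only the left-hand [rho ER hE phiR] is expanded as [phiS] after its lift; the other occurrence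
   sits inside that lift on the right. *)
by rewrite -{1}(halphaS ER hE (rho ER hE phiR)) /= ffunE.
Qed.
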